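(* Let $(X,d,W)$ be a $UCW$-hyperbolic space with a monotone modulus of uniform convexity $\eta$, $C\subseteq X$ a nonempty convex subset, and $T:C\to C$ nonexpansive with $F(T)\neq\emptyset$. Let $(\lambda_n),(s_n)$ be sequences in $[0,1]$ and, for $x\in C$, let $(x_n)$ be the Ishikawa iteration starting with $x$. Assume that $\sum_{n=0}^\infty\lambda_n(1-\lambda_n)$ diverges, $\limsup_n s_n<1$ and $\sum_{n=0}^\infty s_n(1-\lambda_n)$ converges. Then for all $x\in C$, $\lim_{n\to\infty}d(x_n,Tx_n)=0$. Furthermore, if $\theta:\mathbb{N}\to\mathbb{N}$ is a rate of divergence for $\sum_{n=0}^\infty\lambda_n(1-\lambda_n)$, $L,N_0\in\mathbb{N}$ (with $L\ge1$) are such that $s_n\le1-\frac1L$ for all $n\ge N_0$, and $\gamma$ is a Cauchy modulus for $\sum_{n=0}^\infty s_n(1-\lambda_n)$, then for all $x\in C$ and all $b>0$ such that $b\ge d(x,p)$ for some $p\in F(T)$, $$\forall\varepsilon>0\ \forall n\ge\Phi(\varepsilon,\eta,b,\theta,L,N_0,\gamma)\ \big(d(x_n,Tx_n)<\varepsilon\big),$$ where $$\Phi(\varepsilon,\eta,b,\theta,L,N_0,\gamma):=\begin{cases}\theta\left(\left\lceil\dfrac{2L(b+1)}{\varepsilon\cdot\eta\left(b,\frac{\varepsilon}{2Lb}\right)}\right\rceil+\gamma\left(\dfrac{\varepsilon}{8b}\right)+N_0+1\right)&\text{for }\varepsilon\le4Lb,\\[2mm]\gamma\left(\dfrac{\v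arepsilon}{8b}\right)+N_0+1&\text{otherwise.}\end{cases}$$
   Context: A $W$-hyperbolic space $(X,d,W)$ is a metric space $(X,d)$ with a map $W:X\times X\times[0,1]\to X$ such that for all $x,y,z,w\in X$, $\lambda,\tilde\lambda\in[0,1]$: (W1) $d(z,W(x,y,\lambda))\le(1-\lambda)d(z,x)+\lambda d(z,y)$; (W2) $d(W(x,y,\lambda),W(x,y,\tilde\lambda))=|\lambda-\tilde\lambda|\,d(x,y)$; (W3) $W(x,y,\lambda)=W(y,x,1-\lambda)$; (W4) $d(W(x,z,\lambda),W(y,w,\lambda))\le(1-\lambda)d(x,y)+\lambda d(z,w)$. Write $(1-\lambda)x\oplus\lambda y:=W(x,y,\lambda)$. A nonempty $C\subseteq X$ is convex if $(1-\lambda)x\oplus\lambda y\in C$ for all $x,y\in C$, $\lambda\in[0,1]$. $(X,d,W)$ is uniformly convex with modulus of uniform convexity $\eta:(0,\infty)\times(0,2]\to(0,1]$ if for all $r>0$, $\varepsilon\in(0,2]$, $a,x,y\in X$: $d(x,a)\le r$, $d(y,a)\le r$, $d(x,y)\ge\varepsilon r$ imply $d(\frac12x\oplus\frac12y,a)\le(1-\eta(r,\varepsilon))r$. The modulus $\eta$ is monotone if it decreases with $r$ for fixed $\varepsilon$ (i.e. $\eta(s,\varepsilon)\le\eta(r,\varepsilon)$ whenever $s\ge r$). A $UCW$-hyperbolic space is a uniformly convex $W$-hyperbolic space admitting a monotone modulus of uniform convexity. $T:C\to C$ is nonexpansive if $d(Tx,Ty)\le d(x,y)$ for all $x,y\in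 C$; $F(T)$ is the set of fixed points of $T$. The Ishikawa iteration starting with $x\in C$ is $x_0:=x$, $x_{n+1}:=(1-\lambda_n)x_n\oplus\lambda_nT((1-s_n)x_n\oplus s_nTx_n)$. $\mathbb{N}$ includes $0$. A rate of divergence of a divergent series $\sum_{n=0}^\infty a_n$ is a function $\theta:\mathbb{N}\to\mathbb{N}$ with $\sum_{i=0}^{\theta(n)}a_i\ge n$ for all $n\in\mathbb{N}$. A Cauchy modulus of a convergent series $\sum_{n=0}^\infty a_n$ is a function $\gamma:(0,\infty)\to\mathbb{N}$ such that the partial sums $\sigma_n:=\sum_{i=0}^na_i$ satisfy $|\sigma_{\gamma(\varepsilon)+n}-\sigma_{\gamma(\varepsilon)}|<\varepsilon$ for all $\varepsilon>0$, $n\in\mathbb{N}$. *)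

(* Defs.v *)
From HB Require Import structures.
From mathcomp Require Import all_boot all_order all_algebra.
From mathcomp Require Import all_classical all_reals all_analysis.

Set Implicit Arguments.
Unset Strict Implicit.
Unset Printing Implicit Defensive.

Import Order.TTheory GRing.Theory Num.Theory.
Import numFieldTopology.Exports numFieldNormedType.Exports.

Local Open Scope classical_set_scope.
Local Open Scope ring_scope.

(* [W x y l] is the point written (1 - l) x (+) l y. Its third argument ranges
   over all of R; the axioms only constrain it on [0, 1], and the values outside
   this interval are irrelevant. *)
Record W_hyperbolic (R : realType) (X : metricType R) (W : X -> X -> R -> X)
    : Prop := WHyperbolic {
  W1 : forall (x y z : X) (l : R), 0 <= l <= 1 ->
    mdist z (W x y l) <= (1 - l) * mdist z x + l * mdist z y ;
  W2 : forall (x y : X) (l l' : R), 0 <= l <= 1 -> 0 <= l' <= 1 ->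
    mdist (W x y l) (W x y l') = `|l - l'| * mdist x y ;
  W3 : forall (x y : X) (l : R), 0 <= l <= 1 ->
    W x y l = W y x (1 - l) ;
  W4 : forall (x y z w : X) (l : R), 0 <= l <= 1 ->
    mdist (W x z l) (W y w l) <= (1 - l) * mdist x y + l * mdist z w
}.

Definition W_convex (R : realType) (X : metricType R) (W : X -> X -> R -> X)
    (C : set X) : Prop :=
  forall (x y : X) (l : R), C x -> C y -> 0 <= l <= 1 -> C (W x y l).

(* The modulus is a function (0, oo) x (0, 2] -> (0, 1]; it is represented by a
   total function that is constrained only on that domain. *)
Definition modulus_uniform_convexity (R : realType) (X : metricType R)
    (W : X -> X -> R -> X) (eta : R -> R -> R) : Prop :=
  (forall r e : R, 0 < r -> 0 < e <= 2 -> 0 < eta r e <= 1) /\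
  (forall (r e : R) (a x y : X), 0 < r -> 0 < e <= 2 ->
    mdist x a <= r -> mdist y a <= r -> e * r <= mdist x y ->
    mdist (W x y (1 / 2)) a <= (1 - eta r e) * r).

Definition monotone_modulus (R : realType) (eta : R -> R -> R) : Prop :=
  forall r s e : R, 0 < r -> r <= s -> 0 < e <= 2 -> eta s e <= eta r e.

Definition nonexpansive (R : realType) (X : metricType R) (C : set X)
    (T : X -> X) : Prop :=
  forall x y : X, C x -> C y -> mdist (T x) (T y) <= mdist x y.

Definition fixed_points (X : Type) (C : set X) (T : X -> X) : set X :=
  [set p | C p /\ T p = p].

Fixpoint ishikawa (R : realType) (X : metricType R) (W : X -> X -> R -> X)
    (T : X -> X) (lambda s : nat -> R) (x : X) (n : nat) : X :=
  if n is m.+1 then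
    let xm := ishikawa W T lambda s x m in
    W xm (T (W xm (T xm) (s m))) (lambda m)
  else x.

(* [series a n] sums the indices i < n, hence the successors: the partial sum up
   to and including index n is [series a n.+1]. *)
Definition rate_of_divergence (R : realType) (a : nat -> R)
    (theta : nat -> nat) : Prop :=
  forall n : nat, n%:R <= series a (theta n).+1.

Definition cauchy_modulus (R : realType) (a : nat -> R)
    (gamma : R -> nat) : Prop :=
  forall (e : R) (n : nat), 0 < e ->
    `|series a (gamma e + n).+1 - series a (gamma e).+1| < e.

(* [Num.ceil] is int-valued; for 0 < eps <= 4 L b its argument is positive, so
   the absolute value only casts it to nat. *)
Definition Phi (R : realType) (eps : R) (eta : R -> R -> R) (b : R)
    (theta : nat -> nat) (L N0 : nat) (gamma : R -> nat) : nat :=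
  if eps <= 4 * L%:R * b then
    theta (`|Num.ceil (2 * L%:R * (b + 1)
                       / (eps * eta b (eps / (2 * L%:R * b))))%R|
           + gamma (eps / (8 * b))%R + N0 + 1)%N
  else (gamma (eps / (8 * b))%R + N0 + 1)%N.

(* Main.v *)
(** Put y_n = W x_n (T x_n) (s_n) and let p be a fixed point. The distances
    d(x_n, p) decrease, and (1 - s_n) d(x_n, T x_n) <= d(x_n, T y_n), so as long
    as d(x_n, T x_n) >= eps / 2 uniform convexity forces d(x_n, p) to drop by a
    fixed multiple of lambda_n (1 - lambda_n). As these sum to infinity, a
    residual below eps / 2 must occur within a computable range of indices. From
    then on d(x_{n+1}, T x_{n+1}) <= (1 + 2 s_n (1 - lambda_n)) d(x_n, T x_n)
    and the Cauchy modulus keep the residual below eps. The limit statement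
    follows from the rate, by choosing moduli for the given series. *)

Require Import Defs.
From HB Require Import structures.
From mathcomp Require Import all_boot all_order all_algebra.
From mathcomp Require Import all_classical all_reals all_analysis.
From mathcomp Require Import ring lra.

Import Order.TTheory GRing.Theory Num.Theory.
Import numFieldTopology.Exports numFieldNormedType.Exports.

Local Open Scope classical_set_scope.
Local Open Scope ring_scope.

(** * Uniform convexity for arbitrary weights *)

Section HyperbolicGeometry.
Context {R : realType} {X : metricType R} (W : X -> X -> R -> X).
Context (hW : W_hyperbolic W).
Implicit Types (a x y z : X) (l r e : R).

Lemma W_at0 x y : W x y 0 = x.
Proof.
have h : 0 <= (0 : R) <= 1 by lra.
apply/esym/mdist_positivity/eqP; rewrite eq_le mdist_ge0 andbT.
by have := W1 hW x y x h; rewrite mdistxx mulr0 mul0r addr0.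
Qed.

Lemma mdist_Wl x y l : 0 <= l <= 1 -> mdist x (W x y l) = l * mdist x y.
Proof.
move=> hl; have h : 0 <= (0 : R) <= 1 by lra.
have := W2 hW x y h hl; rewrite W_at0 => ->.
by rewrite sub0r normrN ger0_norm//; case/andP: hl.
Qed.

Lemma mdist_Wr x y l : 0 <= l <= 1 -> mdist (W x y l) y = (1 - l) * mdist x y.
Proof.
move=> hl; have hl' : 0 <= 1 - l <= 1 by lra.
by rewrite (W3 hW)// metric_sym mdist_Wl// (metric_sym y).
Qed.

Context (eta : R -> R -> R).
Context (heta : modulus_uniform_convexity W eta).

(* If z differed from W x y l, the midpoint of the two would be strictly
   closer to x than l d(x, y), so passing through it would be a shortcut from
   x to y. *)
Lemma W_unique x y z l : 0 <= l <= 1 ->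
  mdist x z <= l * mdist x y -> mdist z y <= (1 - l) * mdist x y ->
  z = W x y l.
Proof.
move=> hl hxz hzy; apply/eqP; rewrite -[_ == _]negbK -mdist_gt0.
apply/negP => uz.
set u := W x y l in uz *.
have hxu : mdist x u = l * mdist x y by rewrite mdist_Wl.
have huy : mdist u y = (1 - l) * mdist x y by rewrite mdist_Wr.
set r := l * mdist x y in hxz hxu.
have tri : mdist z u <= 2 * r.
  have := metric_triangle z x u; rewrite (metric_sym z x); lra.
have r0 : 0 < r by lra.
(* With this choice the separation hypothesis of the modulus holds with equality. *)
have he : 0 < mdist z u / r <= 2 by rewrite divr_gt0//= ler_pdivrMr.
have := heta.2 r _ x z u r0 he; rewrite !(metric_sym _ x).
move=> /(_ hxz); rewrite hxu divfK ?gt_eqF// => /(_ (lexx _) (lexx _)) hmx.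
have h12 : 0 <= (1 / 2 : R) <= 1 by lra.
have := W1 hW z u y h12; rewrite !(metric_sym y) => hmy.
have /andP[eta0 _] := heta.1 r _ r0 he.
have := mulr_gt0 eta0 r0.
have := metric_triangle x (W z u (1 / 2)) y.
rewrite /r in hmx *; lra.
Qed.

(** Both distances of the right-hand point fit [W_unique], the one to [y] by the triangle inequality
    through the midpoint. This reduces other weights to [1 / 2], the one treated by the modulus. *)
Lemma W_halve x y l : 0 <= l <= 1 / 2 ->
  W x y l = W x (W x y (1 / 2)) (2 * l).
Proof.
move=> hl; have h12 : 0 <= (1 / 2 : R) <= 1 by lra.
have h2l : 0 <= 2 * l <= 1 by lra.
set m := W x y (1 / 2); apply/esym/W_unique; first by lra.
- by rewrite mdist_Wl// mdist_Wl//; lra.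
- have := metric_triangle (W x m (2 * l)) m y.
  by rewrite mdist_Wr// mdist_Wl// mdist_Wr//; lra.
Qed.

(** By [W_halve], [W1] averages the bound [r] at [x] with the sharper bound at the midpoint, which
    has weight [2 * l]. *)
Lemma uniform_convexity_halfW r e a x y l : 0 < r -> 0 < e <= 2 ->
  0 <= l <= 1 / 2 -> mdist x a <= r -> mdist y a <= r -> e * r <= mdist x y ->
  mdist (W x y l) a <= (1 - 2 * l * eta r e) * r.
Proof.
move=> r0 he hl hx hy hxy; rewrite W_halve// metric_sym.
have h2l : 0 <= 2 * l <= 1 by lra.
apply: le_trans (W1 hW _ _ a h2l) _; rewrite !(metric_sym a).
have hm := heta.2 r e a x y r0 he hx hy hxy.
have h1 := ler_wpM2l (_ : 0 <= 1 - 2 * l) hx.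
have h2 := ler_wpM2l (_ : 0 <= 2 * l) hm.
have := h1 ltac:(lra); have := h2 ltac:(lra); lra.
Qed.

(** Since [l * (1 - l)] is at most [l] and at most [1 - l], the previous estimate suffices, after
    exchanging [x] and [y] by [W3] when [l > 1 / 2]. *)
Lemma uniform_convexityW r e a x y l : 0 < r -> 0 < e <= 2 ->
  0 <= l <= 1 -> mdist x a <= r -> mdist y a <= r -> e * r <= mdist x y ->
  mdist (W x y l) a <= (1 - 2 * (l * (1 - l)) * eta r e) * r.
Proof.
move=> r0 he hl hx hy hxy; have /andP[eta0 _] := heta.1 r e r0 he.
have er0 := mulr_gt0 eta0 r0; set E := eta r e * r in er0.
have ll0 : 0 <= l * (1 - l) by nra.
have [l12|l12] := lerP l (1 / 2).
  apply: le_trans (uniform_convexity_halfW r e _ _ _ _ r0 he _ hx hy hxy) _.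
    by lra.
  have : l * (1 - l) * E <= l * E by rewrite ler_pM2r//; nra.
  by rewrite /E; lra.
rewrite (W3 hW)//; rewrite metric_sym in hxy.
apply: le_trans (uniform_convexity_halfW r e _ _ _ _ r0 he _ hy hx hxy) _.
  by lra.
have : l * (1 - l) * E <= (1 - l) * E by rewrite ler_pM2r//; nra.
by rewrite /E; lra.
Qed.

End HyperbolicGeometry.

(** * Ishikawa orbits: residuals and distances to a fixed point *)

Section Ishikawa.
Context {R : realType} {X : metricType R} (W : X -> X -> R -> X).
Context (hW : W_hyperbolic W) (C : set X) (C_convex : W_convex W C).
Context (T : X -> X) (T_maps : forall x : X, C x -> C (T x)).
Context (T_nonexp : nonexpansive C T).
Context (lambda s : nat -> R).
Context (lambda01 : forall n : nat, 0 <= lambda n <= 1).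
Context (s01 : forall n : nat, 0 <= s n <= 1).
Context (x : X) (Cx : C x).

Let u := ishikawa W T lambda s x.
Let v n := W (u n) (T (u n)) (s n).

Lemma ishikawa_in n : C (u n).
Proof.
elim: n => [//|n IH]; apply: C_convex => //; apply: T_maps.
by apply: C_convex => //; exact: T_maps.
Qed.

Lemma ishikawa_inner_in n : C (v n).
Proof.
by apply: C_convex => //; [|apply: T_maps]; exact: ishikawa_in.
Qed.

Let D n := mdist (u n) (T (u n)).

Lemma mdist_ishikawa_T n : (1 - s n) * D n <= mdist (u n) (T (v n)).
Proof.
have := metric_triangle (u n) (T (v n)) (T (u n)).
have := T_nonexp (u n) (v n) (ishikawa_in n) (ishikawa_inner_in n).
by rewrite (mdist_Wl _ hW)// (metric_sym (T (v n)) (T (u n))) -/(D n); lra.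
Qed.

(** The triangle inequality through [T (v n)] leaves [(1 - lambda n) * mdist (u n) (T (v n))] plus
    [mdist (v n) (u n.+1)]. In units of [D n] these are at most [(1 - lambda n) * (1 + s n)] and
    [(1 - lambda n) * s n + lambda n]. *)
Lemma ishikawa_residual_step n :
  D n.+1 <= (1 + 2 * (s n * (1 - lambda n))) * D n.
Proof.
have Cu := ishikawa_in n; have Cv := ishikawa_inner_in n.
have uE : u n.+1 = W (u n) (T (v n)) (lambda n) by [].
have huv : mdist (u n) (v n) = s n * D n by rewrite (mdist_Wl _ hW).
have hTuv : mdist (T (u n)) (T (v n)) <= s n * D n.
  by rewrite -huv; exact: T_nonexp.
have huTv := metric_triangle (u n) (T (u n)) (T (v n)).
have hvTv := metric_triangle (v n) (T (u n)) (T (v n)).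
have hvTu : mdist (v n) (T (u n)) = (1 - s n) * D n by rewrite (mdist_Wr _ hW).
have hvu' := W1 hW (u n) (T (v n)) (v n) (lambda01 n).
rewrite -uE (metric_sym (v n) (u n)) huv in hvu'.
have hu'Tv : mdist (u n.+1) (T (v n)) = (1 - lambda n) * mdist (u n) (T (v n)).
  by rewrite uE (mdist_Wr _ hW).
have hTT := T_nonexp (v n) (u n.+1) Cv (ishikawa_in n.+1).
have := metric_triangle (u n.+1) (T (v n)) (T (u n.+1)).
rewrite -/(D n.+1) hu'Tv.
rewrite -/(D n) in huTv *.
have /andP[l0 l1] := lambda01 n.
have h1 : (1 - lambda n) * mdist (u n) (T (v n)) <=
    (1 - lambda n) * ((1 + s n) * D n).
  by apply: ler_wpM2l; lra.
have h2 : lambda n * mdist (v n) (T (v n)) <= lambda n * D n.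
  by apply: ler_wpM2l; lra.
lra.
Qed.

Context (p : X) (Fp : fixed_points C T p).

Lemma mdist_T_fixed y : C y -> mdist (T y) p <= mdist y p.
Proof. by move=> Cy; case: Fp => Cp Tp; rewrite -{1}Tp; exact: T_nonexp. Qed.

Lemma ishikawa_inner_fixed n : mdist (T (v n)) p <= mdist (u n) p.
Proof.
apply: le_trans (mdist_T_fixed _ (ishikawa_inner_in n)) _.
have := W1 hW (u n) (T (u n)) p (s01 n); rewrite -/(v n) !(metric_sym p).
have := mdist_T_fixed _ (ishikawa_in n); have /andP[s0 _] := s01 n.
move=> /(ler_wpM2l s0); lra.
Qed.

Lemma ishikawa_fejer n : mdist (u n.+1) p <= mdist (u n) p.
Proof.
have := W1 hW (u n) (T (v n)) p (lambda01 n).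
rewrite !(metric_sym p); have /andP[l0 _] := lambda01 n.
have := ler_wpM2l l0 (ishikawa_inner_fixed n).
rewrite [X in mdist X p <= _ -> _](_ : _ = u n.+1)//; lra.
Qed.

Context (b : R) (xpb : mdist x p <= b).

Lemma ishikawa_fixed_le n : mdist (u n) p <= b.
Proof. by elim: n => [//|n]; exact/le_trans/ishikawa_fejer. Qed.

Lemma ishikawa_residual_fixed n : D n <= 2 * mdist (u n) p.
Proof.
have := metric_triangle (u n) p (T (u n)); rewrite (metric_sym p).
have := mdist_T_fixed _ (ishikawa_in n); rewrite -/(D n); lra.
Qed.

(** As residuals are at most [2 * b], the relative error of each step becomes an additive one, and
    the errors sum to a difference of partial sums. *)
Lemma ishikawa_residual_drift k j :
  D (k + j) <= D k + 4 * b * (series (fun n => s n * (1 - lambda n)) (k + j)%N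
                              - series (fun n => s n * (1 - lambda n)) k).
Proof.
elim: j => [|j IH]; first by rewrite addn0 subrr mulr0 addr0.
rewrite addnS; apply: le_trans (ishikawa_residual_step _) _.
rewrite seriesSr.
have /andP[l0 l1] := lambda01 (k + j); have /andP[s0 s1] := s01 (k + j).
have sl0 : 0 <= s (k + j)%N * (1 - lambda (k + j)%N) by apply: mulr_ge0; lra.
have D2b : D (k + j)%N <= 2 * b.
  have := ishikawa_residual_fixed (k + j).
  by have := ishikawa_fixed_le (k + j); lra.
have := ler_wpM2l sl0 D2b; lra.
Qed.

Lemma ishikawa_residual_lt (gamma : R -> nat) (eps : R) (N n : nat) :
  cauchy_modulus (fun n => s n * (1 - lambda n)) gamma ->
  0 < b -> 0 < eps -> (gamma (eps / (8 * b)) < N)%N -> D N < eps / 2 ->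
  (N <= n)%N -> D n < eps.
Proof.
move=> hgamma b0 eps0 gN DN /subnKC <-.
apply: le_lt_trans (ishikawa_residual_drift _ _) _.
set S := series _; set g := gamma _ in gN.
have S_nd : {homo S : k m / (k <= m)%N >-> k <= m}.
  apply: nondecreasing_series => k _ _.
  by have := lambda01 k; have := s01 k; move=> h1 h2; apply: mulr_ge0; lra.
have e0 : 0 < eps / (8 * b) by rewrite divr_gt0// mulr_gt0.
set m := (N + (n - N))%N.
(* [series] excludes its upper index, so the modulus compares [S g.+1] with [S m.+1]; since [g < N],
   both [S N] and [S m] lie between them. *)
have hm : S m - S N < eps / (8 * b).
  have := hgamma (eps / (8 * b)) (m - g)%N e0; rewrite -/g -/S.
  rewrite subnKC; last first.
    by rewrite (leq_trans (ltnW gN))// leq_addr.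
  move=> /(le_lt_trans (ler_norm _)).
  by have := S_nd _ _ gN; have := S_nd _ _ (leqnSn m); lra.
have : 4 * b * (S m - S N) < 4 * b * (eps / (8 * b)).
  by rewrite ltr_pM2l// mulr_gt0.
(* The drift may consume half of [eps]; the residual at [N] takes the other half. *)
have -> : 4 * b * (eps / (8 * b)) = eps / 2 by field; rewrite gt_eqF.
lra.
Qed.

(** * Finding a small residual by uniform convexity *)

Context (eta : R -> R -> R) (heta : modulus_uniform_convexity W eta).
Context (heta_mono : monotone_modulus eta).
Context (L N0 : nat) (L1 : (1 <= L)%N).
Context (sL : forall n : nat, (N0 <= n)%N -> s n <= 1 - 1 / L%:R).
Context (b0 : 0 < b) (eps : R) (eps0 : 0 < eps) (epsb : eps <= 4 * L%:R * b).

Let E := eta b (eps / (2 * L%:R * b)).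

Let L0 : 0 < L%:R :> R. Proof. by rewrite ltr0n. Qed.

(** The case condition of [Phi] amounts to membership in the domain of the modulus. *)
Let eps'_itv : 0 < eps / (2 * L%:R * b) <= 2.
Proof.
have Lb : 0 < 2 * L%:R * b by rewrite !mulr_gt0.
by rewrite divr_gt0//= ler_pdivrMr//; move: epsb; lra.
Qed.

(** Uniform convexity is applied with the actual radius [r = mdist (u n) p]; monotonicity of [eta]
    then replaces [eta r] by the constant [E], because [r <= b]. *)
Lemma ishikawa_decrease n : (N0 <= n)%N -> eps / 2 <= D n ->
  mdist (u n.+1) p <=
  mdist (u n) p - E * eps / (2 * L%:R) * (lambda n * (1 - lambda n)).
Proof.
move=> N0n hD; set r := mdist (u n) p.
have rb : r <= b by exact: ishikawa_fixed_le.
have hfar : eps / (2 * L%:R) <= mdist (u n) (T (v n)).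
  apply: le_trans (mdist_ishikawa_T n).
  have hs : 1 / L%:R <= 1 - s n by have := sL n N0n; lra.
  have -> : eps / (2 * L%:R) = 1 / L%:R * (eps / 2).
    by rewrite invfM mul1r mulrA mulrC.
  by apply: ler_pM => //; rewrite divr_ge0// ltW.
(* Together with [hfar] this gives [eps / (2 * L) <= 2 * r]: hence [r > 0], and the drop,
   proportional to [2 * r], has a bound free of [n]. *)
have r2 : mdist (u n) (T (v n)) <= 2 * r.
  have := metric_triangle (u n) p (T (v n)); rewrite (metric_sym p).
  by have := ishikawa_inner_fixed n; rewrite -/r; lra.
have d0 : 0 < eps / (2 * L%:R) by rewrite divr_gt0// mulr_gt0.
have r0 : 0 < r by lra.
have hE : eps / (2 * L%:R * b) * r <= mdist (u n) (T (v n)).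
  apply: le_trans hfar; rewrite invfM mulrA -mulrA ler_piMr ?(ltW d0)//.
  by rewrite mulrC ler_pdivrMr ?mul1r.
have := uniform_convexityW W hW eta heta r _ p (u n) (T (v n)) (lambda n) r0
  eps'_itv (lambda01 n) (lexx _) (ishikawa_inner_fixed n) hE.
move=> /le_trans; apply.
have EE := heta_mono r b _ r0 rb eps'_itv; rewrite -/E in EE.
have /andP[E0 _] := heta.1 b _ b0 eps'_itv; rewrite -/E in E0.
have /andP[l0 l1] := lambda01 n.
have ll0 : 0 <= lambda n * (1 - lambda n) by apply: mulr_ge0; lra.
have h1 : E * (eps / (2 * L%:R)) <= eta r (eps / (2 * L%:R * b)) * (2 * r).
  by apply: ler_pM => //; lra.
have := ler_wpM2r ll0 h1; rewrite mulrA; lra.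
Qed.

(** Otherwise the distance to [p], at most [b] at index [k], would drop by at least [b + 1] up to
    index [M.+1] and become negative. *)
Lemma ishikawa_residual_hit (theta : nat -> nat) k : (N0 <= k)%N ->
  rate_of_divergence (fun n => lambda n * (1 - lambda n)) theta ->
  exists N, [/\ (k <= N)%N,
    (N <= theta (`|Num.ceil (2 * L%:R * (b + 1) / (eps * E))%R| + k))%N
    & D N < eps / 2].
Proof.
move=> N0k htheta; set P := `|Num.ceil _|%N; set M := theta (P + k)%N.
have [//|hN] := pselect (exists N, [/\ (k <= N)%N, (N <= M)%N & D N < eps / 2]).
set S := series (fun n => lambda n * (1 - lambda n)).
have hdec j : (k + j <= M.+1)%N ->
    mdist (u (k + j)) p <=
    mdist (u k) p - E * eps / (2 * L%:R) * (S (k + j)%N - S k).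
  elim: j => [|j IH] hj; first by rewrite addn0 subrr mulr0 subr0.
  rewrite addnS in hj *; have hD : eps / 2 <= D (k + j)%N.
    rewrite leNgt; apply/negP => hlt; apply: hN.
    by exists (k + j)%N; split=> //; exact: leq_addr.
  have := ishikawa_decrease (k + j) (leq_trans N0k (leq_addr _ _)) hD.
  by have := IH (ltnW hj); rewrite /S seriesSr; lra.
(* The terms are at most 1, so the first [k] of them use up at most [k] of the sum [P + k]
   guaranteed by [theta]; this also forces [k <= M.+1]. *)
have Sn n : S n <= n%:R.
  elim: n => [|n IH]; first by rewrite /S /series/= big_geq.
  rewrite /S seriesSr -/S -natr1; have := lambda01 n; nra.
have hS := htheta (P + k)%N; rewrite -/M -/S natrD in hS.
have P0 := ler0n R P.
have kM : (k <= M.+1)%N by rewrite -(ler_nat R); have := Sn M.+1; lra.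
have := hdec (M.+1 - k)%N; rewrite subnKC// => /(_ (leqnn _)).
have /andP[E0 _] := heta.1 b _ b0 eps'_itv; rewrite -/E in E0.
have eE0 : 0 < eps * E by rewrite mulr_gt0.
have hP : 2 * L%:R * (b + 1) / (eps * E) <= P%:R.
  by apply: le_trans (ceil_ge _) _; rewrite /P natr_absz ler_int ler_norm.
have c0 : 0 < E * eps / (2 * L%:R) by rewrite divr_gt0 ?mulr_gt0.
have hc : b + 1 <= E * eps / (2 * L%:R) * (S M.+1 - S k).
  have /le_trans : b + 1 <=
      E * eps / (2 * L%:R) * (2 * L%:R * (b + 1) / (eps * E)).
    rewrite [leRHS](_ : _ = b + 1)//; field.
    by rewrite !gt_eqF.
  by apply; rewrite ler_pM2l//; have := Sn k; lra.
by have := ishikawa_fixed_le k; have := mdist_ge0 (u M.+1) p; lra.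
Qed.

End Ishikawa.

(** * Existence of the quantitative data *)

Section Moduli.
Context {R : realType}.
Implicit Types (a : nat -> R).

(** The limsup is the infimum of the suprema of tails, so some tail has its supremum below [c]. *)
Lemma limn_sup_lt_near a c : bounded_fun (a : nat -> R^o) -> limn_sup a < c ->
  \forall n \near \oo, a n < c.
Proof.
move=> ba; rewrite limn_supE// => /inf_lt.
have h0 : range (sups a) !=set0 by exists (sups a 0); exists 0%N.
move=> /(_ h0)[_ [N _ <-] hN]; exists N => // n /= Nn.
apply: le_lt_trans hN; apply: ub_le_sup; last by exists n.
exact/has_ubound_sdrop/bounded_fun_has_ubound.
Qed.

Lemma rate_of_divergence_exists a : (forall n, 0 <= a n) ->
  ~ cvgn (series a) -> exists theta, rate_of_divergence a theta.
Proof.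
move=> a0 adv; have S_nd : nondecreasing_seq (series a).
  exact: nondecreasing_series.
have /choice[theta htheta] : forall n, exists m, n%:R <= series a m.+1.
  move=> n; have /cvgryPge/(_ n%:R)[m _ hm] := nondecreasing_dvgn_lt S_nd adv.
  by exists m; apply: hm => /=.
by exists theta.
Qed.

Lemma cauchy_modulus_exists a :
  cvgn (series a) -> exists gamma, cauchy_modulus a gamma.
Proof.
move=> acv.
have /choice[gamma hgamma] : forall e : R, exists N : nat, forall n, 0 < e ->
    `|series a (N + n).+1 - series a N.+1| < e.
  (* The value 0 for [e <= 0] is a default, making the chosen function total. *)
  move=> e; have [e0|e0] := ltrP 0 e; last by exists 0%N.
  have /cvgrPdist_lt/(_ (e / 2)) := acv.
  rewrite divr_gt0// => /(_ isT)[N _ hN]; exists N => n _.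
  have := hN (N + n).+1 (leqW (leq_addr _ _)); have := hN N.+1 (leqnSn _) => /=.
  set l := lim _; move=> h1 h2.
  have -> : series a (N + n).+1 - series a N.+1 =
    (l - series a N.+1) - (l - series a (N + n).+1) by ring.
  by rewrite (le_lt_trans (ler_normB _ _))//; lra.
by exists gamma => e n; exact: hgamma.
Qed.

Lemma archimedean_gap (c : R) : c < 1 ->
  exists2 L : nat, (1 <= L)%N & c <= 1 - 1 / L%:R.
Proof.
move=> c1; have c0 : 0 < 1 - c by lra.
exists (Num.truncn (1 - c)^-1).+1 => //.
rewrite lerBrDr addrC -lerBrDr.
rewrite ler_pdivrMr// mulrC -ler_pdivrMr// mul1r.
exact/ltW/truncnS_gt.
Qed.

End Moduli.

Theorem theorem4p7 (R : realType) (X : metricType R) (W : X -> X -> R -> X)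
    (eta : R -> R -> R) (C : set X) (T : X -> X) (lambda s : nat -> R)
    (hW : W_hyperbolic W)
    (heta : modulus_uniform_convexity W eta)
    (heta_mono : monotone_modulus eta)
    (C_nonempty : C !=set0)
    (C_convex : W_convex W C)
    (T_maps : forall x : X, C x -> C (T x))
    (T_nonexp : nonexpansive C T)
    (FT_nonempty : fixed_points C T !=set0)
    (lambda01 : forall n : nat, 0 <= lambda n <= 1)
    (s01 : forall n : nat, 0 <= s n <= 1)
    (lambda_dvg : ~ cvgn (series (fun n : nat => lambda n * (1 - lambda n))))
    (s_limsup : limn_sup s < 1)
    (s_cvg : cvgn (series (fun n : nat => s n * (1 - lambda n)))) :
  (forall x : X, C x ->
    (fun n : nat => mdist (ishikawa W T lambda s x n)
                          (T (ishikawa W T lambda s x n))) @ \oo --> (0 : R))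
  /\
  (forall (theta : nat -> nat) (L N0 : nat) (gamma : R -> nat),
    rate_of_divergence (fun n : nat => lambda n * (1 - lambda n)) theta ->
    (1 <= L)%N ->
    (forall n : nat, (N0 <= n)%N -> s n <= 1 - 1 / L%:R) ->
    cauchy_modulus (fun n : nat => s n * (1 - lambda n)) gamma ->
    forall (x : X) (b : R), C x -> 0 < b ->
      (exists2 p : X, fixed_points C T p & mdist x p <= b) ->
      forall (eps : R) (n : nat), 0 < eps ->
        (Phi eps eta b theta L N0 gamma <= n)%N ->
        mdist (ishikawa W T lambda s x n)
              (T (ishikawa W T lambda s x n)) < eps).
Proof.
have rate (theta : nat -> nat) (L N0 : nat) (gamma : R -> nat) :
    rate_of_divergence (fun n : nat => lambda n * (1 - lambda n)) theta ->
    (1 <= L)%N ->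
    (forall n : nat, (N0 <= n)%N -> s n <= 1 - 1 / L%:R) ->
    cauchy_modulus (fun n : nat => s n * (1 - lambda n)) gamma ->
    forall (x : X) (b : R), C x -> 0 < b ->
      (exists2 p : X, fixed_points C T p & mdist x p <= b) ->
      forall (eps : R) (n : nat), 0 < eps ->
        (Phi eps eta b theta L N0 gamma <= n)%N ->
        mdist (ishikawa W T lambda s x n)
              (T (ishikawa W T lambda s x n)) < eps.
  move=> htheta L1 sL hgamma x b Cx b0 [p Fp xpb] eps n eps0.
  rewrite /Phi; case: ifPn => [epsb|]; last first.
    (* Here every residual is at most [2 * b < 4 * L * b < eps]. *)
    rewrite -ltNge => epsb _.
    have := ishikawa_residual_fixed _ _ C_convex _ T_maps T_nonexp
      _ _ lambda01 s01 _ Cx _ Fp n.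
    have := ishikawa_fixed_le _ hW _ C_convex _ T_maps T_nonexp
      _ _ lambda01 s01 _ Cx _ Fp _ xpb n.
    have : 1 * b <= L%:R * b by rewrite ler_pM2r// ler1n.
    lra.
  (* This start index is at least [N0] and strictly exceeds the value of [gamma], as the two lemmas
     require. *)
  rewrite -!addnA; set k := (gamma _ + _)%N => hn.
  have N0k : (N0 <= k)%N by rewrite /k addnCA leq_addr.
  have [N [kN NM DN]] := ishikawa_residual_hit _ hW _ C_convex _ T_maps T_nonexp
    _ _ lambda01 s01 _ Cx _ Fp _ xpb _ heta heta_mono _ _ L1 sL b0 _ eps0 epsb
    _ _ N0k htheta.
  apply: (ishikawa_residual_lt _ hW _ C_convex _ T_maps T_nonexp
    _ _ lambda01 s01 _ Cx _ Fp _ xpb _ _ N) => //; first exact: hgamma.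
    by apply: leq_trans kN; rewrite /k addnA addn1 ltnS leq_addr.
  exact: leq_trans hn.
split=> // x Cx.
have ll0 n : 0 <= lambda n * (1 - lambda n).
  by have /andP[l0 l1] := lambda01 n; rewrite mulr_ge0// subr_ge0.
have [theta htheta] := rate_of_divergence_exists _ ll0 lambda_dvg.
have [gamma hgamma] := cauchy_modulus_exists _ s_cvg.
have s_bounded : bounded_fun (s : nat -> R^o).
  exists 1; split=> // M M1 n _ /=.
  by have /andP[s0 s1] := s01 n; rewrite ger0_norm// (le_trans s1)// ltW.
(* The midpoint of the limsup and 1 lies strictly above the former and strictly below the latter. *)
have [N0 _ hN0] : \forall n \near \oo, s n < (limn_sup s + 1) / 2.
  by apply: limn_sup_lt_near => //; lra.
have [L L1 hL] : exists2 L, (1 <= L)%N & (limn_sup s + 1) / 2 <= 1 - 1 / L%:R.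
  by apply: archimedean_gap; lra.
have sL n : (N0 <= n)%N -> s n <= 1 - 1 / L%:R.
  by move=> /hN0/= /ltW/le_trans; apply.
have [p Fp] := FT_nonempty.
(* Adding 1 keeps the bound positive even when [x = p]. *)
have b0 : 0 < mdist x p + 1 by rewrite ltr_wpDl// mdist_ge0.
have xpb : exists2 q : X, fixed_points C T q & mdist x q <= mdist x p + 1.
  by exists p => //; rewrite lerDl.
apply/cvgrPdist_lt => eps eps0.
exists (Phi eps eta (mdist x p + 1) theta L N0 gamma) => // n /= hn.
rewrite sub0r normrN ger0_norm ?mdist_ge0//.
exact: (rate theta L N0 gamma _ L1 sL _ _ _ Cx b0 xpb).
Qed.
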